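(* For all $n \geq 2$, the lowest power of $q$ appearing (with nonzero coefficient) in $NTI_{2n,\mu}(q)$ is $q^n$, and the lowest power of $q$ appearing in $NTI_{2n+1,\mu}(q)$ is also $q^n$.
   Context: For $m\ge 1$ let $\mathcal{C}_m$ be the set of $m$-cycles in the symmetric group $S_m$ (cyclic arrangements of $\{1,\dots,m\}$). An $m$-cycle is written $C=(c_0,c_1,\dots,c_{m-1})$ with $c_0=1$, and is traversed from left to right cyclically. We say $c_s$ is cyclically between $c_i$ and $c_j$ if $i<s<j$, or $j<i<s$, or $s<j<i$. For $a<b$ in $\{1,\dots,m\}$, the pair $\langle a,b\rangle$ is an occurrence of $\mu$ (a $\mu$-match) in $C$ if there is no $x$ with $a<x<b$ that is cyclically between $a$ and $b$ in $C$; it is nontrivial if $a+1<b$. $NT_\mu(C)$ denotes the number of nontrivial $\mu$-matches in $C$. An $m$-cycle is incontractible if there is no $i$ with $1\le i\le m-1$ such that $i+1$ immediately follows $i$ in $C$; $\mathcal{IC}_m$ is the set of incontractible $m$-cycles. Define $NTI_{m,\mu}(q)=\sum_{C\in\mathcal{IC}_m} q^{NT_\mu(C)}$. *)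

(* Defs.v *)
From mathcomp Require Import all_boot all_order all_fingroup all_algebra.

Set Implicit Arguments.
Unset Strict Implicit.
Unset Printing Implicit Defensive.

Import GRing.Theory.

(* The labels 1, ..., m are encoded as 0, ..., m - 1 : 'I_m;
   all the notions below only involve the order and successor of labels. *)

Definition mcycles (m : nat) : {set 'S_m} :=
  [set C : 'S_m | porbits C == [set [set: 'I_m]]].

(* The word c_0 c_1 ... c_{m-1} with c_0 the least label and c_{i+1} = C c_i
   (the empty word if m = 0). *)
Definition cycle_word (m : nat) (C : 'S_m) : seq 'I_m :=
  if insub 0 is Some c0 then traject C c0 m else [::].

Definition cycle_pos (m : nat) (C : 'S_m) (x : 'I_m) : nat :=
  index x (cycle_word C).

(* The last argument x is the label lying between a and b. *)
Definition cyclically_between (m : nat) (C : 'S_m) (a b x : 'I_m) : bool :=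
  let i := cycle_pos C a in
  let j := cycle_pos C b in
  let s := cycle_pos C x in
  [|| i < s < j, j < i < s | s < j < i].

Definition mu_match (m : nat) (C : 'S_m) (a b : 'I_m) : bool :=
  (a < b) && ~~ [exists x : 'I_m, (a < x < b) && cyclically_between C a b x].

Definition NT_mu (m : nat) (C : 'S_m) : nat :=
  #|[set ab : 'I_m * 'I_m | mu_match C ab.1 ab.2 && (ab.1.+1 < ab.2)]|.

(* In an m-cycle, C i is the label immediately following i; the largest label
   m - 1 never satisfies the equation. *)
Definition incontractible (m : nat) (C : 'S_m) : bool :=
  ~~ [exists i : 'I_m, C i == i.+1 :> nat].

Definition IC (m : nat) : {set 'S_m} :=
  [set C in mcycles m | incontractible C].

Definition NTI_mu (m : nat) : {poly int} :=
  (\sum_(C in IC m) 'X^(NT_mu C))%R.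

Definition lowest_power (p : {poly int}) (k : nat) : Prop :=
  (p`_k != 0)%R /\ forall j : nat, j < k -> (p`_j = 0)%R.

(* Main.v *)
(** Write [a -> b] for the arc of a cycle leading from [a] to [b].  If [i+1] does
    not follow [i], some label lies on the arc [i -> i+1].  If one of these
    labels exceeds [i+1], the least such [y] gives a nontrivial match [<i,y>];
    otherwise the greatest such [y < i] gives a nontrivial match [<y,i+1>].
    Charging each match [<a,b>] by [a] and by [b-1], the [m-1] indices [i] are
    covered by two charges per match, so there are at least [(m-1)/2] matches.
    With [h] the upper half of [m], the cycle [(0, h, 1, h+1, 2, ...)] has no
    nontrivial match besides the [<i, i+h>], hence it attains the bound. *)
Require Import Defs.
From mathcomp Require Import all_boot all_order all_fingroup all_algebra.
From mathcomp Require Import zify.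

Set Implicit Arguments.
Unset Strict Implicit.
Unset Printing Implicit Defensive.

(** * Positions along the word of a cycle *)

Lemma cycle_wordE m (C : 'S_m.+1) : cycle_word C = traject C ord0 m.+1.
Proof.
rewrite /cycle_word; case: insubP => [u _ u0|//].
by congr (traject _ _ _); apply: val_inj.
Qed.

Lemma cycle_word_uniq m (C : 'S_m.+1) :
  C \in mcycles m.+1 -> uniq (cycle_word C).
Proof.
rewrite inE cycle_wordE => /eqP CE.
have: porbit C ord0 \in porbits C by rewrite imset_f.
rewrite CE inE => /eqP orb0; have := uniq_traject_porbit C ord0.
by rewrite orb0 cardsT card_ord.
Qed.

Lemma mem_cycle_word m (C : 'S_m.+1) x :
  C \in mcycles m.+1 -> x \in cycle_word C.
Proof.
rewrite inE cycle_wordE => /eqP CE.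
have: porbit C ord0 \in porbits C by rewrite imset_f.
rewrite CE inE => /eqP orb0; have := porbit_traject C ord0 x.
by rewrite orb0 cardsT card_ord inE => <-.
Qed.

Lemma size_cycle_word m (C : 'S_m.+1) : size (cycle_word C) = m.+1.
Proof. by rewrite cycle_wordE size_traject. Qed.

Lemma cycle_pos_lt m (C : 'S_m.+1) x :
  C \in mcycles m.+1 -> cycle_pos C x < m.+1.
Proof. by move=> Cm; rewrite -[ltnRHS](size_cycle_word C) index_mem mem_cycle_word. Qed.

Lemma iter_cycle_pos m (C : 'S_m.+1) x :
  C \in mcycles m.+1 -> iter (cycle_pos C x) C ord0 = x.
Proof.
move=> Cm; rewrite -(nth_traject C (cycle_pos_lt x Cm)) -cycle_wordE.
by rewrite nth_index // mem_cycle_word.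
Qed.

Lemma cycle_pos_iter m (C : 'S_m.+1) k :
  C \in mcycles m.+1 -> k < m.+1 -> cycle_pos C (iter k C ord0) = k.
Proof.
move=> Cm ltk; rewrite -(nth_traject C ltk) -cycle_wordE /cycle_pos.
by rewrite index_uniq ?size_cycle_word ?cycle_word_uniq.
Qed.

Lemma cycle_pos_inj m (C : 'S_m.+1) :
  C \in mcycles m.+1 -> injective (cycle_pos C).
Proof.
by move=> Cm x y eqxy; rewrite -(iter_cycle_pos x Cm) eqxy iter_cycle_pos.
Qed.

Lemma cycle_posS m (C : 'S_m.+1) x : C \in mcycles m.+1 ->
  cycle_pos C x < m -> cycle_pos C (C x) = (cycle_pos C x).+1.
Proof.
by move=> Cm ltx; rewrite -[in C x](iter_cycle_pos x Cm) -iterS cycle_pos_iter.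
Qed.

(** If [C x] stood at a position [k.+1], injectivity of [C] would put [x] at position [k], short of
    the end of the word. *)
Lemma cycle_pos_last m (C : 'S_m.+1) x : C \in mcycles m.+1 ->
  cycle_pos C x = m -> cycle_pos C (C x) = 0.
Proof.
move=> Cm xm; have lty := cycle_pos_lt (C x) Cm.
case y: (cycle_pos C (C x)) lty => [//|k] ltk.
have Ck : C (iter k C ord0) = C x.
  by rewrite -iterS -y iter_cycle_pos.
have := cycle_pos_iter Cm (ltnW ltk); rewrite (perm_inj Ck) xm; lia.
Qed.

(** The first inner label of a nonempty arc is the successor of its start; if [a] ends the word,
    this label is at position 0 and the wrap-around clause applies. *)
Lemma cyclically_between_next m (C : 'S_m.+1) (a b : 'I_m.+1) :
  C \in mcycles m.+1 -> a != b -> C a != b -> cyclically_between C a b (C a).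
Proof.
move=> Cm; rewrite -(inj_eq (cycle_pos_inj Cm)) -[C a == b](inj_eq (cycle_pos_inj Cm)).
rewrite /cyclically_between /=.
have := cycle_pos_lt a Cm; have := cycle_pos_lt b Cm.
have [ltam|] := ltnP (cycle_pos C a) m; first by rewrite cycle_posS //; lia.
move=> lema ltb lta; rewrite (cycle_pos_last Cm); lia.
Qed.

(** * The lower bound *)

Definition nontrivial_matches m (C : 'S_m) : {set 'I_m * 'I_m} :=
  [set ab : 'I_m * 'I_m | mu_match C ab.1 ab.2 && (ab.1.+1 < ab.2)].

Lemma nontrivial_match_charged m (C : 'S_m.+1) (i j : 'I_m.+1) :
    C \in IC m.+1 -> j = i.+1 :> nat ->
  (exists y, (i, y) \in nontrivial_matches C) \/
  (exists y, (y, j) \in nontrivial_matches C).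
Proof.
rewrite inE => /andP[Cm Cinc] ji.
have iNj : i != j by rewrite -val_eqE /=; lia.
have Cij : C i != j.
  apply: contra Cinc => /eqP Cij; apply/existsP; exists i.
  by rewrite Cij ji.
have btwC := cyclically_between_next Cm iNj Cij.
have [|/existsPn noup] := boolP [exists y : 'I_m.+1, (j < y) && cyclically_between C i j y].
  case/existsP=> y0 Py0; left; exists
    [arg min_(y < y0 | (j < y) && cyclically_between C i j y) (y : nat)].
  case: arg_minnP => // y /andP[jy btwy] ymin; rewrite inE /= /mu_match.
  have -> : i.+1 < y by lia.
  have -> /= : i < y by lia.
  rewrite andbT; apply/existsPn => x; apply/negP => /andP[/andP[ix xy] btwx].
  (* The arc from [i] to [y] is part of the arc from [i] to [j], so [x > j] contradicts the
     minimality of [y]; and [j] itself lies beyond [y]. *)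
  have [jx|] := ltnP j x.
    suff: cyclically_between C i j x by move=> btwx'; have := ymin x; rewrite jx btwx'; lia.
    by move: btwy btwx; rewrite /cyclically_between /=; lia.
  move=> xj; have {}xj : x = j by apply: val_inj => /=; lia.
  by move: btwy btwx; rewrite xj /cyclically_between /=; lia.
(* The first label on the arc is neither [i] nor [j] and does not exceed [j], so it lies below [i];
   it is the initial candidate for the maximum. *)
have Ci_lt : C i < i.
  have := noup (C i); rewrite btwC andbT -leqNgt.
  move: Cij btwC; rewrite -val_eqE /= leq_eqVlt => /negPf -> btwC /= Cij.
  have : C i != i :> nat.
    by apply: contraTneq btwC => /val_inj ->; rewrite /cyclically_between; lia.
  lia.
right; exists [arg max_(y > C i | (y < i) && cyclically_between C i j y) (y : nat)].
case: arg_maxnP => [|y /andP[yi btwy] ymax]; first by rewrite Ci_lt.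
rewrite inE /= /mu_match.
have -> : y.+1 < j by lia.
have -> /= : y < j by lia.
rewrite andbT; apply/existsPn => x; apply/negP => /andP[/andP[yx xj] btwx].
have [xi|] := ltnP x i.
  suff: cyclically_between C i j x by move=> btwx'; have := ymax x; rewrite xi btwx'; lia.
  by move: btwy btwx; rewrite /cyclically_between /=; lia.
move=> ix; have {ix} xi : x = i by apply: val_inj => /=; lia.
by move: btwy btwx; rewrite xi /cyclically_between /=; lia.
Qed.

Lemma NT_mu_ge m (C : 'S_m) : C \in IC m -> m./2 <= NT_mu C.
Proof.
case: m C => [|m] C CIC; first by [].
rewrite -[NT_mu C]/#|nontrivial_matches C|; set M := nontrivial_matches C.
pose A := [set ab.1 | ab in M].
(* The predecessor stays below [m.+1], so [inord] never takes its default value. *)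
pose B := [set (inord ab.2.-1 : 'I_m.+1) | ab : 'I_m.+1 * 'I_m.+1 in M].
have : [set~ ord_max] \subset A :|: B.
  apply/subsetP => i; rewrite !inE -val_eqE /= => im.
  have ltim : i.+1 < m.+1 by have := ltn_ord i; lia.
  case: (nontrivial_match_charged (j := Ordinal ltim) CIC erefl) => -[y yM].
    by apply/orP; left; apply/imsetP; exists (i, y).
  by apply/orP; right; apply/imsetP; exists (y, Ordinal ltim); rewrite //= inord_val.
move/subset_leq_card; rewrite cardsC1 card_ord /= => lem.
(* Here [m.+1./2] is [uphalf m] by computation: [m] charged labels, two per match, rounded up. *)
rewrite leq_uphalf_double -addnn.
apply: leq_trans lem (leq_trans (leq_card_setU A B).1 _).
by apply: leq_add; apply: leq_imset_card.
Qed.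

(** * The extremal cycle *)

Definition shuffle_label m k := if odd k then uphalf m + k./2 else k./2.

(** Inverse of [shuffle_label m] below [m], which is the perfect out-shuffle: the lower half sits on
    the even positions and is rounded up because these are in excess for odd [m]. *)
Definition shuffle_pos m x :=
  if x < uphalf m then x.*2 else (x - uphalf m).*2.+1.

Lemma shuffle_label_lt m k : k < m -> shuffle_label m k < m.
Proof. by rewrite /shuffle_label; case: ifP; lia. Qed.

Lemma shuffle_pos_lt m x : x < m -> shuffle_pos m x < m.
Proof. by rewrite /shuffle_pos; case: ifP; lia. Qed.

Lemma shuffle_posK m x : x < m -> shuffle_label m (shuffle_pos m x) = x.
Proof. by rewrite /shuffle_pos /shuffle_label; case: ifP; case: ifP; lia. Qed.

Lemma shuffle_labelK m k : k < m -> shuffle_pos m (shuffle_label m k) = k.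
Proof. by rewrite /shuffle_pos /shuffle_label; case: ifP; case: ifP; lia. Qed.

(** Rotation of the positions, conjugated by the shuffle. *)
Definition shuffle_next m (x : 'I_m.+1) : 'I_m.+1 :=
  inord (shuffle_label m.+1 ((shuffle_pos m.+1 x).+1 %% m.+1)).

Lemma shuffle_next_inj m : injective (@shuffle_next m).
Proof.
have ltmod k : k %% m.+1 < m.+1 by rewrite ltn_mod.
rewrite /shuffle_next => x y /(congr1 val) /=.
rewrite !inordK ?shuffle_label_lt //.
move=> /(congr1 (shuffle_pos m.+1)); rewrite !shuffle_labelK // => exy.
apply: val_inj; rewrite /= -(shuffle_posK (ltn_ord x)) -(shuffle_posK (ltn_ord y)).
move: exy; rewrite -[(shuffle_pos _ x).+1]addn1 -[(shuffle_pos _ y).+1]addn1.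
move=> /eqP; rewrite eqn_modDr => /eqP exy; congr shuffle_label.
by move: exy; rewrite !modn_small ?shuffle_pos_lt.
Qed.

(* The cycle [(0, h, 1, h+1, 2, ...)] with [h = uphalf m.+1]. *)
Definition shuffle_cycle m : 'S_m.+1 := perm (@shuffle_next_inj m).

Lemma iter_shuffle_cycle m k : k < m.+1 ->
  iter k (shuffle_cycle m) ord0 = shuffle_label m.+1 k :> nat.
Proof.
elim: k => [|k IHk] ltk //; rewrite iterS permE /shuffle_next IHk ?(ltnW ltk) //.
by rewrite shuffle_labelK ?(ltnW ltk) // modn_small // inordK ?shuffle_label_lt.
Qed.

Lemma shuffle_cycle_mcycle m : shuffle_cycle m \in mcycles m.+1.
Proof.
have orbT x : porbit (shuffle_cycle m) x = [set: 'I_m.+1].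
  have in0 y : y \in porbit (shuffle_cycle m) ord0.
    suff -> : y = iter (shuffle_pos m.+1 y) (shuffle_cycle m) ord0.
      by rewrite -permX mem_porbit.
    apply: val_inj; rewrite /= iter_shuffle_cycle ?shuffle_pos_lt //.
    by rewrite shuffle_posK.
  apply/setP => y; rewrite inE; have := in0 x; rewrite -eq_porbit_mem => /eqP ->.
  exact: in0.
rewrite inE eqEsubset; apply/andP; split; apply/subsetP => A.
  by case/imsetP => x _ ->; rewrite orbT inE.
by rewrite inE => /eqP ->; rewrite -(orbT ord0) imset_f.
Qed.

Lemma cycle_pos_shuffle m x : cycle_pos (shuffle_cycle m) x = shuffle_pos m.+1 x.
Proof.
have ltx := shuffle_pos_lt (ltn_ord x).
rewrite -(cycle_pos_iter (shuffle_cycle_mcycle m) ltx); congr cycle_pos.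
by apply: val_inj; rewrite /= iter_shuffle_cycle // shuffle_posK.
Qed.

(** Every ascent of the cycle is by [uphalf m.+1], which is at least 2 once [m > 1]. *)
Lemma shuffle_cycle_IC m : 1 < m -> shuffle_cycle m \in IC m.+1.
Proof.
move=> m_gt1; have Cm := shuffle_cycle_mcycle m.
rewrite inE Cm /=; apply/existsPn => i; apply/negP => /eqP Ci.
have := cycle_pos_lt i Cm; rewrite ltnS leq_eqVlt => /predU1P[im|im].
  have := cycle_pos_last Cm im; rewrite cycle_pos_shuffle Ci.
  by rewrite /shuffle_pos; case: ifP; lia.
have := cycle_posS Cm im; rewrite !cycle_pos_shuffle Ci.
by rewrite /shuffle_pos; case: ifP; case: ifP; lia.
Qed.

Lemma shuffle_matches m (a b : 'I_m.+1) :
  (a, b) \in nontrivial_matches (shuffle_cycle m) -> b = a + uphalf m.+1 :> nat.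
Proof.
rewrite inE => /andP[/andP[/= ltab /existsPn nobtw] ntab]; set h := uphalf m.+1.
have ltb := ltn_ord b.
have nbtw x : a < x < b ->
    let i := shuffle_pos m.+1 a in let j := shuffle_pos m.+1 b in
    let s := shuffle_pos m.+1 x in ~~ [|| i < s < j, j < i < s | s < j < i].
  move=> axb; have ltx : x < m.+1 by lia.
  by have := nobtw (Ordinal ltx); rewrite /cyclically_between !cycle_pos_shuffle axb.
(* The label [a.+1] rules out pairs inside one half, and [b = h] with [a > 0]; [a + h] rules out
   [b > a + h] for [a < h]; [h] rules out [h < b < a + h] for [a < h]. *)
have := nbtw a.+1; have := nbtw (a + h); have := nbtw h.
rewrite /= /shuffle_pos -/h; do ?case: ifP; lia.
Qed.

(** A match is determined by its lower label [a], and [a + uphalf m.+1 <= m] leaves [m.+1./2] values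
    for it. *)
Lemma NT_mu_shuffle m : NT_mu (shuffle_cycle m) <= m.+1./2.
Proof.
rewrite -[NT_mu _]/#|nontrivial_matches _|; set M := nontrivial_matches _.
have injM : {in M &, injective (fun ab : 'I_m.+1 * 'I_m.+1 => ab.1)}.
  move=> [a b] [a' b'] /shuffle_matches/= eb /shuffle_matches/= eb' /= ea.
  by rewrite ea; congr pair; apply: val_inj; rewrite /= eb eb' ea.
rewrite -(card_in_imset injM).
have half_le : m.+1./2 <= m.+1 by lia.
have injw : injective (widen_ord half_le).
  by move=> i j /(congr1 val) /= /val_inj.
rewrite -[leqRHS]card_ord -[leqRHS](card_imset _ injw).
apply/subset_leq_card/subsetP => _ /imsetP[[a b] /shuffle_matches/= eb ->].
have lta : a < m.+1./2 by have := ltn_ord b; lia.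
by apply/imsetP; exists (Ordinal lta) => //; apply: val_inj.
Qed.

(** * Coefficients of the generating polynomial *)

Import GRing.Theory Num.Theory.

(** As counts, the coefficients cannot cancel: one vanishes exactly when no cycle has that number of
    matches. *)
Lemma coef_NTI_mu m k :
  ((NTI_mu m)`_k = #|[set C in IC m | NT_mu C == k]|%:R)%R.
Proof.
rewrite /NTI_mu coef_sum -sum1_card natr_sum.
rewrite (eq_bigr (fun C => if NT_mu C == k then 1%R : int else 0%R)); last first.
  by move=> C _; rewrite coefXn eq_sym; case: eqP.
by rewrite -big_mkcondr; apply: eq_bigl => C; rewrite inE.
Qed.

Lemma lowest_power_NTI_mu m : 2 < m -> lowest_power (NTI_mu m) m./2.
Proof.
case: m => // m m_gt1; split=> [|j ltj]; rewrite coef_NTI_mu.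
  have CIC := shuffle_cycle_IC m_gt1.
  rewrite pnatr_eq0 -lt0n card_gt0; apply/set0Pn; exists (shuffle_cycle m).
  by rewrite inE CIC eqn_leq NT_mu_shuffle NT_mu_ge.
apply/eqP; rewrite pnatr_eq0 cards_eq0; apply/set0Pn => -[C].
by rewrite inE => /andP[/NT_mu_ge geC /eqP eC]; lia.
Qed.

Theorem corollary7 (n : nat) (hn : 2 <= n) :
  lowest_power (NTI_mu (2 * n)) n /\ lowest_power (NTI_mu (2 * n + 1)) n.
Proof.
have evenP := @lowest_power_NTI_mu (2 * n).
have oddP := @lowest_power_NTI_mu (2 * n + 1).
have e1 : (2 * n)./2 = n by lia.
have e2 : (2 * n + 1)./2 = n by lia.
by rewrite e1 in evenP; rewrite e2 in oddP; split; [apply: evenP | apply: oddP]; lia.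
Qed.
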